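(* Let $\mathcal{N}$ be a complete homogeneous network with asymmetric input, with monoid of input maps $\Sigma$, fundamental network $\mathcal{F}=(\Sigma,\Sigma)$, class of constructible networks $\mathfrak{C}_{\mathcal{N}}=\mathfrak{C}_{\mathcal{F}}$ and network multipliers $\Lambda^1,\dots,\Lambda^k$. Then the following holds. (6) $\mathcal{F}\in\mathfrak{C}_{\mathcal{N}}$, and $m^{\mathcal{F}}_l\neq 0$ for all $l\in\{1,\dots,k\}$. In other words, every network multiplier of $\mathfrak{C}_{\mathcal{N}}$ contributes to the spectrum of $\Gamma_f$. (7) Let $V$ be a finite dimensional complex vector space. Given linear response functions $f,g:V^{\Sigma}\to V$, there exists a unique linear response function $h:V^{\Sigma}\to V$ such that $\Gamma_f\circ\Gamma_g=\Gamma_h$. It then also holds that $\gamma^{\mathcal{M}}_f\circ\gamma^{\mathcal{M}}_g=\gamma^{\mathcal{M}}_h$ for every network $\mathcal{M}\in\mathfrak{C}_{\mathcal{N}}$. Moreover, if $\mathcal{C}_f,\mathcal{C}_g,\mathcal{C}_h$ denote the coefficients of $f,g,h$, then $\Lambda^l(\mathcal{C}_f)\circ\Lambda^l(\mathcal{C}_g)=\Lambda^l(\mathcal{C}_h)$ for all $l\in\{1,\dots,k\}$.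
   Context: A homogeneous network with asymmetric input, with arrow types indexed by a finite set $\mathcal{T}$, is a finite set $N$ of nodes together with an input map $\sigma_{\mathcal{N}}:N\to N$ for each $\sigma\in\mathcal{T}$ (often just written $\sigma$; $\sigma(p)$ is the source of the unique arrow of type $\sigma$ targeting $p$). A network $\mathcal{N}=(N,\Sigma)$ given by a set $\Sigma$ of maps $N\to N$ is complete if $\Sigma$ is a monoid under composition with unit $\mathrm{Id}_N$. Its fundamental network $\mathcal{F}=(\Sigma,\Sigma)$ has node set $\Sigma$ and input maps $\kappa\mapsto\sigma\circ\kappa$ for $\sigma\in\Sigma$. The input network $\mathcal{M}_p$ of a node $p$ of a network $\mathcal{M}$ consists of $p$ and all nodes obtained from $p$ by applying finitely many input maps, with the restricted input maps. For two networks with arrow types indexed by $\Sigma$, a graph fibration is a map $F$ of node sets with $F\circ\sigma=\sigma\circ F$ for all $\sigma\in\Sigma$, and a network is a quotient of another if there is a surjective graph fibration from the latter to the former. The class $\mathfrak{C}_{\mathcal{F}}=\mathfrak{C}_{\mathcal{N}}$ of constructible networks consists of all homogeneous networks with asymmetric input with arrow types indexed by $\Sigma$ (different types may define the same input map) for which the input network of every node is isomorphic to a quotient of $\mathcal{F}$. A linear response function $f:V^{\Sigma}\to V$ has the form $f(w)=\sum_{\sigma\in\Sigma}C_\sigma w_\sigma$ with $C_\sigma\in\mathrm{Lin}(V,V)$; $\mathcal{C}_f=(C_\sigma)_{\sigma\in\Sigma}$ are its coefficients. For a network $\mathcal{M}\in\mathfrak{C}_{\mathcal{N}}$ with node set $N$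 the admissible map $\gamma^{\mathcal{M}}_f:V^N\to V^N$ is $(\gamma^{\mathcal{M}}_f(x))_p=f((x_{\sigma(p)})_{\sigma\in\Sigma})$. For $\mathcal{F}$ it is denoted $\Gamma_f:V^\Sigma\to V^\Sigma$, so $(\Gamma_f(X))_\kappa=f((X_{\sigma\circ\kappa})_{\sigma\in\Sigma})$. Network multipliers: $\mathbb{C}^\Sigma$ is a representation of $\Sigma$ via $(A_\sigma X)_\tau=X_{\tau\circ\sigma}$, and $f\mapsto\Gamma_f$ is a linear bijection from linear response functions $\mathbb{C}^\Sigma\to\mathbb{C}$ to the endomorphisms of this representation. Fix an isomorphism of representations $\mathbb{C}^\Sigma\cong W_1^{n_1}\oplus\dots\oplus W_k^{n_k}$ with $n_l\ge1$ and $W_1,\dots,W_k$ mutually non-isomorphic (nonzero) indecomposable representations. For an endomorphism $F$ let $F^l_{i,j}\in\mathrm{End}(W_l)$ be its component from the $j$th to the $i$th copy of $W_l$, and put $\Lambda^l_{i,j}(F)=\operatorname{tr}(F^l_{i,j})/\dim W_l$. For $c\in\mathbb{C}^\Sigma$ set $\Lambda^l_{i,j}(c):=\Lambda^l_{i,j}(\Gamma_f)$ with $f(x)=\sum_\sigma c_\sigma x_\sigma$; this is linear in $c$, say $\Lambda^l_{i,j}(c)=\sum_\sigma a^{l,\sigma}_{i,j}c_\sigma$. For any finite dimensional complex $V$ and $C\in\mathrm{Lin}(V,V)^\Sigma$ define $\Lambda^l_{i,j}(C)=\sum_\sigma a^{l,\sigma}_{i,j}C_\sigma\in\mathrm{Lin}(V,V)$,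 and let the network multiplier $\Lambda^l(C)$ be the $n_l\times n_l$ block matrix $(\Lambda^l_{i,j}(C))_{i,j}$. For $\mathcal{M}\in\mathfrak{C}_{\mathcal{N}}$, the numbers $m^{\mathcal{M}}_1,\dots,m^{\mathcal{M}}_k$ are the (uniquely determined) non-negative integers such that, for every finite dimensional complex $V$ and linear $f:V^\Sigma\to V$ with coefficients $C$, the eigenvalues of $\gamma^{\mathcal{M}}_f$ counted with algebraic multiplicity are those of $\Lambda^1(C)$ ($m^{\mathcal{M}}_1$ times), ..., together with those of $\Lambda^k(C)$ ($m^{\mathcal{M}}_k$ times). *)

(* Defs.v *)
From HB Require Import structures.
From mathcomp Require Import all_boot all_order all_algebra.

Set Implicit Arguments.
Unset Strict Implicit.
Unset Printing Implicit Defensive.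

Set Warnings "-redundant-canonical-projection".

Import GRing.Theory.
Local Open Scope ring_scope.

Record network (T : finType) := Network {
  node :> finType;
  inp : T -> node -> node }.

Section Networks.
Variable T : finType.
Implicit Types M Q : network T.

Definition reach M : rel M := connect (fun q r => [exists s, inp s q == r]).

Fact reach_inp M (p : M) s (q : {q : M | reach p q}) :
  reach p (inp s (val q)).
Proof.
apply: connect_trans (valP q) (connect1 _).
by apply/existsP; exists s.
Qed.

Definition input_network M (p : M) : network T :=
  @Network T {q : M | reach p q}
    (fun s q => exist _ (inp s (val q)) (reach_inp s q)).

Definition graph_fibration M Q (F : M -> Q) : Prop :=
  forall s p, F (inp s p) = inp s (F p).

Definition is_quotient M Q : Prop :=
  exists F : M -> Q, graph_fibration F /\ (forall q, exists p, F p = q).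

Definition net_iso M Q : Prop :=
  exists F : M -> Q, graph_fibration F /\ bijective F.

Definition constructible (F M : network T) : Prop :=
  forall p : M, exists Q, is_quotient F Q /\ net_iso (input_network p) Q.

End Networks.

(* Sigma is a set of maps, so that distinct arrow types of a complete network
   define distinct input maps. *)
Record complete_network := CompleteNetwork {
  cnode : finType;
  input_maps : {set {ffun cnode -> cnode}};
  id_in : [ffun p => p] \in input_maps;
  comp_in : forall s t, s \in input_maps -> t \in input_maps ->
    [ffun p => s (t p)] \in input_maps }.

Definition Sigma (N : complete_network) : finType :=
  {s : {ffun cnode N -> cnode N} | s \in input_maps N}.

Definition sid (N : complete_network) : Sigma N :=
  exist (fun s => s \in input_maps N) _ (id_in N).

Definition scomp (N : complete_network) (s t : Sigma N) : Sigma N :=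
  exist (fun s => s \in input_maps N) _ (comp_in (valP s) (valP t)).

Definition fundamental (N : complete_network) : network (Sigma N) :=
  @Network (Sigma N) (Sigma N) (@scomp N).

Section Admissible.
Variables (K : fieldType) (T : finType) (V : vectType K).

Definition single (s : T) (v : V) : {ffun T -> V} :=
  [ffun t => if t == s then v else 0].

Fact single_is_linear s : linear (single s).
Proof.
move=> a u v; apply/ffunP => t; rewrite !ffunE.
by case: (t == s); rewrite // scaler0 addr0.
Qed.
HB.instance Definition _ s :=
  GRing.isLinear.Build K V {ffun T -> V} _ (single s) (single_is_linear s).

Definition coefs (f : 'Hom({ffun T -> V}, V)) : {ffun T -> 'End(V)} :=
  [ffun s => linfun (f \o single s)].

Lemma coefsE (f : 'Hom({ffun T -> V}, V)) (w : {ffun T -> V}) :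
  f w = \sum_s coefs f s (w s).
Proof.
have -> : w = \sum_s single s (w s).
  apply/ffunP => t; rewrite sum_ffunE (bigD1 t) //= ffunE eqxx big1 ?addr0 //.
  by move=> s /negPf st; rewrite ffunE eq_sym st.
rewrite linear_sum; apply: eq_bigr => s _; rewrite ffunE lfunE /=.
congr (f (single s _)); rewrite sum_ffunE (bigD1 s) //=.
rewrite ffunE eqxx big1 ?addr0 // => t /negPf st.
by rewrite ffunE eq_sym st.
Qed.

Section Gamma.
Variables (M : network T) (f : 'Hom({ffun T -> V}, V)).

Definition admissible_fun (x : {ffun M -> V}) : {ffun M -> V} :=
  [ffun p => f [ffun s => x (inp s p)]].

Fact admissible_is_linear : linear admissible_fun.
Proof.
move=> a x y; apply/ffunP => p; rewrite !ffunE -linearP; congr (f _).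
by apply/ffunP => s; rewrite !ffunE.
Qed.
HB.instance Definition _ := GRing.isLinear.Build K
  {ffun M -> V} {ffun M -> V} _ admissible_fun admissible_is_linear.

Definition admissible : 'End({ffun M -> V}) := linfun admissible_fun.

Lemma admissibleE x p : admissible x p = f [ffun s => x (inp s p)].
Proof. by rewrite lfunE ffunE. Qed.

End Gamma.
End Admissible.

Section BlockMap.
Variables (K : fieldType) (V : vectType K) (n : nat).
Variable A : 'I_n -> 'I_n -> 'End(V).

Definition block_fun (X : {ffun 'I_n -> V}) : {ffun 'I_n -> V} :=
  [ffun i => \sum_j A i j (X j)].

Fact block_is_linear : linear block_fun.
Proof.
move=> a x y; apply/ffunP => i; rewrite !ffunE scaler_sumr -big_split /=.
by apply: eq_bigr => j _; rewrite !ffunE linearP.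
Qed.
HB.instance Definition _ := GRing.isLinear.Build K
  {ffun 'I_n -> V} {ffun 'I_n -> V} _ block_fun block_is_linear.

Definition block_map : 'End({ffun 'I_n -> V}) := linfun block_fun.

Lemma block_mapE X i : block_map X i = \sum_j A i j (X j).
Proof. by rewrite lfunE ffunE. Qed.

End BlockMap.

(* The choice of basis below does not affect the trace or the characteristic
   polynomial. *)
Definition ltrace (K : fieldType) (V : vectType K) (f : 'End(V)) : K :=
  \tr (passmx.mxof (vbasis {:V}) (vbasis {:V}) f).

Definition alg_mult (K : fieldType) (V : vectType K) (x : K)
    (f : 'End(V)) : nat :=
  mup x (char_poly (passmx.mxof (vbasis {:V}) (vbasis {:V}) f)).

Definition dsum (K : fieldType) (k : nat) (V : 'I_k -> vectType K) : Type :=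
  {dffun forall l, V l}.

Section DirectSum.
Import VectorInternalTheory.
Variables (K : fieldType) (k : nat) (V : 'I_k -> vectType K).
Local Notation DS := (dsum V).

Definition ds_mk (x : forall l, V l) : DS := [ffun l => x l].
Definition ds_proj (l : 'I_k) (x : DS) : V l := fun_of_fin x l.

Lemma ds_mkE x l : ds_proj l (ds_mk x) = x l.
Proof. exact: ffunE. Qed.

Lemma dsP (x y : DS) : (forall l, ds_proj l x = ds_proj l y) <-> x = y.
Proof. exact: ffunP. Qed.

Definition ds_zero : DS := ds_mk (fun l => 0).
Definition ds_opp (x : DS) : DS := ds_mk (fun l => - ds_proj l x).
Definition ds_add (x y : DS) : DS := ds_mk (fun l => ds_proj l x + ds_proj l y).
Definition ds_scale (a : K) (x : DS) : DS := ds_mk (fun l => a *: ds_proj l x).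

HB.instance Definition _ := Choice.copy DS {dffun forall l, V l}.

Fact ds_addA : associative ds_add.
Proof. by move=> x y z; apply/dsP => l; rewrite !ds_mkE addrA. Qed.
Fact ds_addC : commutative ds_add.
Proof. by move=> x y; apply/dsP => l; rewrite !ds_mkE addrC. Qed.
Fact ds_add0 : left_id ds_zero ds_add.
Proof. by move=> x; apply/dsP => l; rewrite !ds_mkE add0r. Qed.
Fact ds_addN : left_inverse ds_zero ds_opp ds_add.
Proof. by move=> x; apply/dsP => l; rewrite !ds_mkE addNr. Qed.

HB.instance Definition _ :=
  GRing.isZmodule.Build DS ds_addA ds_addC ds_add0 ds_addN.

Fact ds_scaleA a b x : ds_scale a (ds_scale b x) = ds_scale (a * b) x.
Proof. by apply/dsP => l; rewrite !ds_mkE scalerA. Qed.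
Fact ds_scale1 : left_id 1 ds_scale.
Proof. by move=> x; apply/dsP => l; rewrite !ds_mkE scale1r. Qed.
Fact ds_scaleDr : right_distributive ds_scale +%R.
Proof. by move=> a x y; apply/dsP => l; rewrite !ds_mkE scalerDr. Qed.
Fact ds_scaleDl x : {morph ds_scale^~ x : a b / a + b}.
Proof. by move=> a b; apply/dsP => l; rewrite !ds_mkE scalerDl. Qed.

HB.instance Definition _ := GRing.Zmodule_isLmodule.Build K DS
  ds_scaleA ds_scale1 ds_scaleDr ds_scaleDl.

Fact ds_proj_is_linear l : linear (ds_proj l).
Proof. by move=> a x y; rewrite !ds_mkE. Qed.
HB.instance Definition _ l :=
  GRing.isLinear.Build K DS (V l) _ (ds_proj l) (ds_proj_is_linear l).

Fact ds_vect_iso : Vector.axiom (\sum_l dim (V l)) DS.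
Proof.
exists (fun x : DS => \mxrow_l v2r (ds_proj l x)).
  by move=> a x y; apply/rowP => t; rewrite !mxE !linearP !mxE.
exists (fun r => ds_mk (fun l => r2v (submxrow r l))) => [x | r].
  by apply/dsP => l; rewrite ds_mkE mxrowK v2rK.
by apply/mxrowP => l; rewrite mxrowK ds_mkE r2vK.
Qed.

HB.instance Definition _ := Lmodule_hasFinDim.Build K DS ds_vect_iso.

End DirectSum.

Record rep (K : fieldType) (N : complete_network) := Rep {
  carrier :> vectType K;
  act : Sigma N -> 'End(carrier);
  act_id : act (sid N) = \1%VF;
  act_comp : forall s t, act (scomp s t) = (act s \o act t)%VF }.

Section Representations.
Variables (K : fieldType) (N : complete_network).
Local Notation rep := (rep K N).
Local Notation S := (Sigma N).

Definition equivariant (U W : rep) (f : 'Hom(U, W)) : Prop :=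
  forall s, (f \o act U s)%VF = (act W s \o f)%VF.

Definition is_rep_iso (U W : rep) (f : 'Hom(U, W)) : Prop :=
  equivariant f /\ bijective f.

Definition rep_iso (U W : rep) : Prop := exists f : 'Hom(U, W), is_rep_iso f.

Definition invariant_subspace (W : rep) (U : {vspace W}) : Prop :=
  forall s, (act W s @: U <= U)%VS.

Definition indecomposable (W : rep) : Prop :=
  ({:W} <> 0)%VS /\
  forall U U' : {vspace W}, invariant_subspace U -> invariant_subspace U' ->
    (U + U' = {:W})%VS -> (U :&: U' = 0)%VS -> U = 0%VS \/ U' = 0%VS.

Section Regular.

Definition reg_fun (s : S) (X : {ffun S -> K^o}) : {ffun S -> K^o} :=
  [ffun t => X (scomp t s)].

Fact reg_is_linear s : linear (reg_fun s).
Proof. by move=> a x y; apply/ffunP => t; rewrite !ffunE. Qed.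
HB.instance Definition _ s := GRing.isLinear.Build K
  {ffun S -> K^o} {ffun S -> K^o} _ (reg_fun s) (reg_is_linear s).

Definition reg_act (s : S) : 'End({ffun S -> K^o}) := linfun (reg_fun s).

Fact reg_act_id : reg_act (sid N) = \1%VF.
Proof.
apply/lfunP => X; rewrite lfunE id_lfunE; apply/ffunP => t; rewrite ffunE.
by congr (X _); apply: val_inj; apply/ffunP => p; rewrite !ffunE.
Qed.

Fact reg_act_comp s t : reg_act (scomp s t) = (reg_act s \o reg_act t)%VF.
Proof.
apply/lfunP => X; rewrite comp_lfunE !lfunE; apply/ffunP => u; rewrite !ffunE.
by congr (X _); apply: val_inj; apply/ffunP => p; rewrite !ffunE.
Qed.

Definition regular_rep : rep := Rep reg_act_id reg_act_comp.

End Regular.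

Section Power.
Variables (W : rep) (n : nat).

Definition pow_fun (s : S) (X : {ffun 'I_n -> W}) : {ffun 'I_n -> W} :=
  [ffun i => act W s (X i)].

Fact pow_is_linear s : linear (pow_fun s).
Proof. by move=> a x y; apply/ffunP => t; rewrite !ffunE linearP. Qed.
HB.instance Definition _ s := GRing.isLinear.Build K
  {ffun 'I_n -> W} {ffun 'I_n -> W} _ (pow_fun s) (pow_is_linear s).

Definition pow_act (s : S) : 'End({ffun 'I_n -> W}) := linfun (pow_fun s).

Fact pow_act_id : pow_act (sid N) = \1%VF.
Proof.
apply/lfunP => X; rewrite lfunE id_lfunE; apply/ffunP => t.
by rewrite ffunE act_id id_lfunE.
Qed.

Fact pow_act_comp s t : pow_act (scomp s t) = (pow_act s \o pow_act t)%VF.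
Proof.
apply/lfunP => X; rewrite comp_lfunE !lfunE; apply/ffunP => u.
by rewrite !ffunE act_comp comp_lfunE.
Qed.

Definition pow_rep : rep := Rep pow_act_id pow_act_comp.

End Power.

Section Sum.
Variables (k : nat) (W : 'I_k -> rep).
Local Notation DS := (dsum W).

Definition sum_fun (s : S) (X : DS) : DS :=
  ds_mk (fun l => act (W l) s (ds_proj l X)).

Fact sum_is_linear s : linear (sum_fun s).
Proof.
move=> a x y; apply/dsP => l.
by rewrite linearP /= !ds_mkE !linearP.
Qed.
HB.instance Definition _ s :=
  GRing.isLinear.Build K DS DS _ (sum_fun s) (sum_is_linear s).

Definition sum_act (s : S) : 'End(DS) := linfun (sum_fun s).

Fact sum_act_id : sum_act (sid N) = \1%VF.
Proof.
apply/lfunP => X; rewrite lfunE id_lfunE; apply/dsP => l.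
by rewrite ds_mkE act_id id_lfunE.
Qed.

Fact sum_act_comp s t : sum_act (scomp s t) = (sum_act s \o sum_act t)%VF.
Proof.
apply/lfunP => X; rewrite comp_lfunE !lfunE; apply/dsP => l.
by rewrite !ds_mkE act_comp comp_lfunE.
Qed.

Definition sum_rep : rep := Rep sum_act_id sum_act_comp.

End Sum.

End Representations.

Record decomposition (K : fieldType) (N : complete_network) := Decomposition {
  ncomp : nat;
  dec_comp : 'I_ncomp -> rep K N;
  dec_mult : 'I_ncomp -> nat;
  mult_ge1 : forall l, (1 <= dec_mult l)%N;
  comp_indecomposable : forall l, indecomposable (dec_comp l);
  comp_distinct : forall l l', l <> l' -> ~ rep_iso (dec_comp l) (dec_comp l');
  dec_iso :
    'Hom(regular_rep K N, sum_rep (fun l => pow_rep (dec_comp l) (dec_mult l)));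
  dec_isoP : is_rep_iso dec_iso }.

Arguments ncomp {K N} d.
Arguments dec_comp {K N} d l.
Arguments dec_mult {K N} d l.
Arguments dec_iso {K N} d.

Section Multipliers.
Variables (K : fieldType) (N : complete_network) (D : decomposition K N).
Local Notation S := (Sigma N).
Local Notation Wsum := (dsum (fun l => pow_rep (dec_comp D l) (dec_mult D l))).

Section Entry.
Variables (l : 'I_(ncomp D)) (i j : 'I_(dec_mult D l)).

Definition copy_in_fun (w : dec_comp D l) : Wsum :=
  ds_mk (dfwith (fun m => 0 : pow_rep (dec_comp D m) (dec_mult D m))
    (single j w)).

Definition copy_out_fun (X : Wsum) : dec_comp D l :=
  (ds_proj l X : {ffun 'I_(dec_mult D l) -> dec_comp D l}) i.

Fact copy_in_is_linear : linear copy_in_fun.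
Proof.
move=> a u v; apply/dsP => m; rewrite linearP /= !ds_mkE.
case: (eqVneq l m) => [<- | lm]; first by rewrite !dfwith_in linearP.
by rewrite !dfwith_out // scaler0 addr0.
Qed.
HB.instance Definition _ := GRing.isLinear.Build K (dec_comp D l) Wsum _
  copy_in_fun copy_in_is_linear.

Fact copy_out_is_linear : linear copy_out_fun.
Proof. by move=> a u v; rewrite /copy_out_fun linearP !ffunE. Qed.
HB.instance Definition _ := GRing.isLinear.Build K Wsum (dec_comp D l) _
  copy_out_fun copy_out_is_linear.

(* As dec_iso is bijective, (dec_iso D)^-1 is its two-sided inverse. *)
Definition component (F : 'End(regular_rep K N)) : 'End(dec_comp D l) :=
  (linfun copy_out_fun \o dec_iso D \o F \o (dec_iso D)^-1
     \o linfun copy_in_fun)%VF.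

Definition mult_entry (F : 'End(regular_rep K N)) : K :=
  ltrace (component F) / (\dim {:dec_comp D l})%:R.

Lemma mult_entry_is_scalar : scalar mult_entry.
Proof.
move=> a F G; rewrite /mult_entry /component !(comp_lfunDr, comp_lfunDl).
rewrite -!(comp_lfunZr, comp_lfunZl) /ltrace passmx.mxof_linear.
by rewrite mxtraceD mxtraceZ mulrDl mulrA.
Qed.

Definition scalar_resp_fun (c : {ffun S -> K}) (x : {ffun S -> K^o}) : K^o :=
  \sum_s c s * x s.

Fact scalar_resp_is_linear c : linear (scalar_resp_fun c).
Proof.
move=> a x y; rewrite /scalar_resp_fun scaler_sumr -big_split /=.
by apply: eq_bigr => s _; rewrite !ffunE mulrDr scalerAr.
Qed.
HB.instance Definition _ c := GRing.isLinear.Build K {ffun S -> K^o} K^o _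
  (scalar_resp_fun c) (scalar_resp_is_linear c).

Definition scalar_resp (c : {ffun S -> K}) : 'Hom({ffun S -> K^o}, K^o) :=
  linfun (scalar_resp_fun c).

Definition mult_scalar (c : {ffun S -> K}) : K :=
  mult_entry (admissible (fundamental N) (scalar_resp c)).

(* The value of the linear form mult_scalar at the unit vector s; see
   mult_scalarE. *)
Definition mult_coef (s : S) : K := mult_scalar [ffun t => (t == s)%:R].

Lemma mult_scalarE c : mult_scalar c = \sum_s mult_coef s * c s.
Proof.
pose A s := admissible (fundamental N) (scalar_resp [ffun t => (t == s)%:R]).
have E : admissible (fundamental N) (scalar_resp c) = \sum_s c s *: A s.
  apply/lfunP => x; apply/ffunP => p.
  rewrite admissibleE sum_lfunE sum_ffunE lfunE; apply: eq_bigr => s _.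
  rewrite scale_lfunE !ffunE /A admissibleE lfunE /= /scalar_resp_fun.
  rewrite (bigD1 s) //= !ffunE eqxx mul1r big1 ?addr0 // => t /negPf st.
  by rewrite !ffunE st mul0r.
rewrite /mult_scalar E.
elim/big_rec2: _ => [|s y F _ <-]; last first.
  by rewrite mult_entry_is_scalar mulrC.
have := mult_entry_is_scalar (-1) 0 0.
by rewrite scaler0 addr0 mulN1r addNr.
Qed.

End Entry.

(* A block matrix with blocks in End(V) is viewed as an endomorphism of V^n. *)
Definition multiplier (V : vectType K) (l : 'I_(ncomp D))
    (C : {ffun S -> 'End(V)}) : 'End({ffun 'I_(dec_mult D l) -> V}) :=
  block_map (fun i j => \sum_s mult_coef i j s *: C s).

(* Equality of the two multisets of eigenvalues, expressed through the
   algebraic multiplicity of every x; meaningful for K algebraically closed. *)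
Definition spectral_mults (M : network S) (m : {ffun 'I_(ncomp D) -> nat}) :
    Prop :=
  forall (V : vectType K) (f : 'Hom({ffun S -> V}, V)) (x : K),
    alg_mult x (admissible M f) =
      (\sum_l m l * alg_mult x (multiplier l (coefs f)))%N.

End Multipliers.

(* Main.v *)
Require Import Defs.
From HB Require Import structures.
From mathcomp Require Import all_boot all_order all_algebra.
From mathcomp Require Import complex reals.

Set Implicit Arguments.
Unset Strict Implicit.
Unset Printing Implicit Defensive.

Import GRing.Theory Num.Theory passmx.
Local Open Scope ring_scope.

(** What the theorem says on multipliers and spectra comes from traces of
    endomorphisms of the regular representation C^Sigma.

    Let W be indecomposable.  By Fitting's lemma an equivariant endomorphism of
    W is bijective or nilpotent, and by the existence of an eigenvalue it is a
    scalar plus a nilpotent one.  Hence the normalized trace tr(F) / dim W is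
    multiplicative on equivariant endomorphisms of W ([ltrace_mul]), and a
    composite W -> U -> W through an indecomposable U that is not isomorphic to
    W has trace zero ([ltrace_through]).  Inserting the resolution of the
    identity of C^Sigma given by the copies of the W_l, it follows that, for
    each l, the matrix of normalized traces is multiplicative in F
    ([mult_entry_mul]).  For the basic admissible maps [shift s], which satisfy
    shift s o shift t = shift (t s), this is the identity [mult_coef_comp]
    between the coefficients a^{l,s}_{i,j}; multiplicativity of the network
    multipliers over an arbitrary V is its bilinear extension
    ([multiplier_comp]).

    The composite of Gamma_f and Gamma_g is the admissible map of the response
    f o Gamma_g ([admissible_comp]); the argument uses only that the input maps
    compose as in Sigma, which constructible networks inherit from the
    fundamental network ([constructible_inp]).  A response is recovered from
    Gamma_f by evaluating at the unit node.

    For the spectrum, tr(Gamma_f) is the sum over l of dim W_l times the trace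
    of the l-th multiplier ([ltrace_Gamma]): this is linear in the coefficients
    and so reduces to the splitting of tr(shift s) along the copies of the W_l.
    By multiplicativity the same identity holds for all powers, and in
    characteristic zero the traces of all powers determine the multiplicities of
    eigenvalues ([alg_mult_of_traces]).  So m_l = dim W_l is a solution, and
    it is positive.  The m_l are unique because the projection of C^Sigma onto
    its l-th isotypic part is some Gamma_f, whose l-th multiplier is the
    identity while the others vanish ([spectral_mults_inj]). *)

(** * Traces, powers and function spaces *)

Section Trace.
Variable K : fieldType.
Implicit Types U V W : vectType K.

Lemma ltraceC U V (f : 'Hom(U, V)) (g : 'Hom(V, U)) :
  ltrace (g \o f)%VF = ltrace (f \o g)%VF.
Proof. by rewrite /ltrace !(mxof_comp _ _ (vbasisP _)) mxtrace_mulC. Qed.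

Fact ltrace_is_scalar V : scalar (@ltrace K V).
Proof.
by move=> a f g; rewrite /ltrace mxof_linear mxtraceD mxtraceZ.
Qed.
HB.instance Definition _ V := GRing.isLinear.Build K 'End(V) K _ (@ltrace K V)
  (@ltrace_is_scalar V).

Lemma ltrace1 V : ltrace (\1 : 'End(V)) = (\dim {:V})%:R.
Proof. by rewrite /ltrace mxof1 ?mxtrace1 // (basis_free (vbasisP _)). Qed.

Lemma comp_lfun_sumr U V W (g : 'Hom(V, W)) I r (P : pred I)
    (f : I -> 'Hom(U, V)) :
  (g \o \sum_(i <- r | P i) f i)%VF = \sum_(i <- r | P i) (g \o f i)%VF.
Proof.
by elim/big_rec2: _ => [|i x y _ <-]; rewrite ?comp_lfun0r ?comp_lfunDr.
Qed.

Lemma comp_lfun_suml U V W (g : 'Hom(U, V)) I r (P : pred I)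
    (f : I -> 'Hom(V, W)) :
  ((\sum_(i <- r | P i) f i) \o g)%VF = \sum_(i <- r | P i) (f i \o g)%VF.
Proof.
by elim/big_rec2: _ => [|i x y _ <-]; rewrite ?comp_lfun0l ?comp_lfunDl.
Qed.

(** The trace of f is the sum of the traces of its diagonal blocks, for any
    family of maps that resolves the identity; no direct sum is formed. *)
Lemma ltrace_split (I : finType) W (U : I -> vectType K)
    (p : forall i, 'Hom(W, U i)) (q : forall i, 'Hom(U i, W)) (f : 'End(W)) :
  \sum_i (q i \o p i)%VF = \1%VF ->
  ltrace f = \sum_i ltrace (p i \o f \o q i)%VF.
Proof.
move=> qp1; rewrite -[f in LHS]comp_lfun1r -qp1 comp_lfun_sumr linear_sum.
apply: eq_bigr => i _; rewrite comp_lfunA -[in RHS]comp_lfunA.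
exact: ltraceC.
Qed.

(** A power by iterated composition, because V may be zero and 'End(V) is a
    ring with 1 <> 0 only for V <> 0. *)
Definition lfun_exp V (f : 'End(V)) k : 'End(V) :=
  iter k (comp_lfun f) \1%VF.

Lemma mxof_exp V (f : 'End(V)) k :
  mxof (vbasis {:V}) (vbasis {:V}) (lfun_exp f k)
  = mxof (vbasis {:V}) (vbasis {:V}) f ^+ k.
Proof.
elim: k => [|k IHk] /=.
  by rewrite mxof1 ?expr0 ?(basis_free (vbasisP _)).
by rewrite (mxof_comp _ _ (vbasisP _)) IHk exprSr.
Qed.

Lemma alg_mult_eigen V (f : 'End(V)) x :
  (0 < alg_mult x f)%N <-> exists2 v, v != 0 & f v = x *: v.
Proof.
rewrite /alg_mult; set A := mxof _ _ f.
have vB := vbasisP {:V}.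
have p0 : char_poly A != 0 by rewrite monic_neq0 ?char_poly_monic.
rewrite -XsubC_dvd // dvdp_XsubCl -eigenvalue_root_char; split.
  case/eigenvalueP => u uA u0; exists (vecof (vbasis {:V}) u).
    by rewrite vecof_eq0.
  by rewrite (hom_vecof _ vB) uA linearZ.
case=> v v0 fv; apply/eigenvalueP; exists (rVof (vbasis {:V}) v).
  by rewrite -(rVof_app _ vB) fv linearZ.
by rewrite rVof_eq0.
Qed.

End Trace.

Lemma lfun_scalar (K : fieldType) (F : 'End(K^o)) (v : K^o) :
  F v = (F 1 : K) * v.
Proof. by rewrite -[v in LHS]mulr1 [LHS]linearZ mulrC. Qed.

Section FunctionSpace.
Variables (K : fieldType) (T : finType) (V : vectType K).

Definition evaluation (t : T) (x : {ffun T -> V}) : V := x t.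

Fact evaluation_is_linear t : linear (evaluation t).
Proof. by move=> a x y; rewrite /evaluation !ffunE. Qed.
HB.instance Definition _ t := GRing.isLinear.Build K {ffun T -> V} V _
  (evaluation t) (evaluation_is_linear t).

Lemma ltrace_ffun (F : 'End({ffun T -> V})) :
  ltrace F = \sum_t ltrace (linfun (evaluation t) \o F \o linfun (single t))%VF.
Proof.
apply: (ltrace_split (p := fun t => linfun (evaluation t))
                     (q := fun t => linfun (single t))).
apply/lfunP => x; rewrite id_lfunE; apply/ffunP => t.
rewrite sum_lfunE sum_ffunE (bigD1 t) //= big1 ?addr0 => [|s st].
  by rewrite comp_lfunE !lfunE /= ffunE eqxx.
by rewrite comp_lfunE !lfunE /= ffunE eq_sym (negPf st).
Qed.

End FunctionSpace.

(** The diagonal block of gamma_f at the node p is the sum of the C_s over the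
    input maps s that fix p. *)
Lemma ltrace_admissible (K : fieldType) (T : finType) (V : vectType K)
    (M : network T) (f : 'Hom({ffun T -> V}, V)) :
  ltrace (admissible M f) =
  \sum_s #|[pred p : M | inp s p == p]|%:R * ltrace (coefs f s).
Proof.
rewrite ltrace_ffun.
have tr_p (p : M) : ltrace (linfun (evaluation p) \o admissible M f \o
    linfun (single p))%VF = \sum_(s | inp s p == p) ltrace (coefs f s).
  rewrite -linear_sum; congr ltrace; apply/lfunP => v.
  rewrite !comp_lfunE lfunE /= /evaluation admissibleE coefsE sum_lfunE.
  rewrite [RHS]big_mkcond; apply: eq_bigr => s _.
  rewrite !ffunE [linfun (single p) v]lfunE /= ffunE.
  by case: ifP; rewrite ?linear0 // !lfunE.
under eq_bigr do rewrite tr_p big_mkcond.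
rewrite exchange_big; apply: eq_bigr => s _ /=.
by rewrite -big_mkcond /= sumr_const mulr_natl.
Qed.

Section Blocks.
Variables (K : fieldType) (V : vectType K) (n : nat).
Implicit Types A B : 'I_n -> 'I_n -> 'End(V).

Lemma ltrace_block A : ltrace (block_map A) = \sum_i ltrace (A i i).
Proof.
rewrite ltrace_ffun; apply: eq_bigr => i _; congr ltrace.
apply/lfunP => v; rewrite !comp_lfunE !lfunE /= /evaluation ffunE (bigD1 i) //=.
rewrite ffunE eqxx big1 ?addr0 // => j /negPf ji.
by rewrite ffunE ji linear0.
Qed.

Lemma block_map_comp A B : (block_map A \o block_map B)%VF
  = block_map (fun i k => \sum_j (A i j \o B j k)%VF).
Proof.
apply/lfunP => x; apply/ffunP => i; rewrite comp_lfunE !block_mapE.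
under eq_bigr do rewrite block_mapE linear_sum.
rewrite exchange_big; apply: eq_bigr => k _; rewrite sum_lfunE.
by apply: eq_bigr => j _; rewrite comp_lfunE.
Qed.

Lemma eq_block_map A B :
  (forall i j, A i j = B i j) -> block_map A = block_map B.
Proof.
move=> AB; apply/lfunP => x; apply/ffunP => i; rewrite !block_mapE.
by apply: eq_bigr => j _; rewrite AB.
Qed.

Lemma block_map_scalar a :
  block_map (fun i j : 'I_n => (a * (i == j)%:R) *: (\1%VF : 'End(V)))
  = a *: \1%VF.
Proof.
apply/lfunP => x; apply/ffunP => i; rewrite block_mapE scale_lfunE.
rewrite id_lfunE ffunE.
rewrite (bigD1 i) //= eqxx mulr1 scale_lfunE id_lfunE big1 ?addr0 // => j ji.
by rewrite eq_sym (negPf ji) mulr0 scale0r zero_lfunE.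
Qed.

End Blocks.

(** * Eigenvalue multiplicities from traces of powers *)

Section TriangularMatrices.
Variable K : fieldType.

Lemma char_poly_similar n (P A B : 'M[K]_n) :
  P \in unitmx -> P *m A = B *m P -> char_poly A = char_poly B.
Proof.
move=> uP PAB; have detP : \det (map_mx polyC P) != 0.
  by rewrite det_map_mx polyC_eq0 -unitfE -unitmxE.
apply: (mulfI detP); rewrite /char_poly -det_mulmx [RHS]mulrC -det_mulmx.
congr (\det _); rewrite /char_poly_mx mulmxBr mulmxBl -!map_mxM /= PAB.
by rewrite scalar_mxC.
Qed.

Lemma trig_mul n (A B : 'M[K]_n) : is_trig_mx A -> is_trig_mx B ->
  is_trig_mx (A *m B) /\ forall i, (A *m B) i i = A i i * B i i.
Proof.
move=> /is_trig_mxP tA /is_trig_mxP tB; split.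
  apply/is_trig_mxP => i j ij; rewrite mxE big1 // => k _.
  have [ik|ki] := ltnP i k; first by rewrite tA ?mul0r.
  by rewrite tB ?mulr0 // (leq_ltn_trans ki).
move=> i; rewrite mxE (bigD1 i) //= big1 ?addr0 // => k ki.
have [ik|ik|/val_inj ik] := ltngtP i k; first by rewrite tA ?mul0r.
  by rewrite tB ?mulr0.
by rewrite ik eqxx in ki.
Qed.

End TriangularMatrices.

Section Eigenvalues.
Variable K : numClosedFieldType.

(** The list s is the diagonal of a triangular matrix similar to A. *)
Lemma mx_spectrum n (A : 'M[K]_n) : exists s : seq K,
  (forall x, mup x (char_poly A) = count_mem x s) /\
  (forall k, \tr (A ^+ k) = \sum_(x <- s) x ^+ k).
Proof.
have [n0|n0] := posnP n.
  subst n; exists [::]; split=> [x|k].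
    by rewrite /char_poly det_mx00 mupNroot // root1.
  by rewrite big_nil /mxtrace big_ord0.
have [P uniP] := Schur A n0.
have uP := unitarymx_unit uniP.
set T := conjmx P A; rewrite /similar_to -/T => trT.
have PA : P *m A = T *m P.
  by rewrite /T /conjmx pinvmxE // mulmxKV.
exists [seq T i i | i <- enum 'I_n]; split=> [x|k].
  rewrite (char_poly_similar uP PA) char_poly_trig //.
  by rewrite -mu_prod_XsubC big_map big_enum.
have PAk : P *m A ^+ k = T ^+ k *m P.
  elim: k => [|k IHk]; first by rewrite !expr0 mulmx1 mul1mx.
  by rewrite !exprS -!mulmxE mulmxA PA -mulmxA IHk mulmxA.
have -> : A ^+ k = invmx P *m (T ^+ k *m P) by rewrite -PAk mulKmx.
rewrite mxtrace_mulC mulmxK // big_map big_enum /=.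
have [_ dT] : is_trig_mx (T ^+ k) /\ forall i, (T ^+ k) i i = T i i ^+ k.
  elim: k {PAk} => [|k [tk dk]].
    by rewrite expr0 scalar_mx_is_trig; split=> // i; rewrite mxE eqxx.
  rewrite exprS; have [? d] := trig_mul trT tk; split=> // i.
  by rewrite d dk exprS.
by apply: eq_bigr => i _.
Qed.

Lemma spectrum (V : vectType K) (f : 'End(V)) : exists s : seq K,
  (forall x, alg_mult x f = count_mem x s) /\
  (forall k, ltrace (lfun_exp f k) = \sum_(x <- s) x ^+ k).
Proof.
have [s [s_mult s_tr]] :=
  mx_spectrum (mxof (vbasis {:V}) (vbasis {:V}) f).
by exists s; split=> // k; rewrite /ltrace mxof_exp.
Qed.

(** Spectra are compared through power sums: sum y^k over the eigenvalues of f
    equals the weighted sum over those of the g_i for all k, so the same holds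
    with y^k replaced by any polynomial in y.  A polynomial that vanishes at all
    the eigenvalues that occur except x counts the multiplicity of x, as a
    natural number embedded in a field of characteristic zero. *)
Lemma alg_mult_of_traces (V : vectType K) (f : 'End(V)) (I : finType)
    (U : I -> vectType K) (g : forall i, 'End(U i)) (m : I -> nat) :
  (forall k, ltrace (lfun_exp f k)
             = \sum_i (m i)%:R * ltrace (lfun_exp (g i) k)) ->
  forall x, alg_mult x f = (\sum_i m i * alg_mult x (g i))%N.
Proof.
move=> tr_eq x; have [s [s_mult s_tr]] := spectrum f.
have [t tP] : exists t : I -> seq K, forall i,
    (forall x, alg_mult x (g i) = count_mem x (t i)) /\
    (forall k, ltrace (lfun_exp (g i) k) = \sum_(x <- t i) x ^+ k).
  by have /fin_all_exists[t tP] := fun i => spectrum (g i); exists t.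
have poly_eq (p : {poly K}) :
    \sum_(y <- s) p.[y] = \sum_i (m i)%:R * \sum_(y <- t i) p.[y].
  under eq_bigr do rewrite horner_coef.
  under [in RHS]eq_bigr do
    (under eq_bigr do rewrite horner_coef; rewrite exchange_big mulr_sumr).
  rewrite exchange_big [RHS]exchange_big; apply: eq_bigr => k _ /=.
  rewrite -mulr_sumr -s_tr tr_eq mulr_sumr; apply: eq_bigr => i _.
  by rewrite (tP i).2 -mulr_sumr mulrCA.
(* p vanishes at every eigenvalue in sight other than x *)
pose p := \prod_(y <- [seq y <- s ++ flatten [seq t i | i <- enum I] | y != x])
  ('X - y%:P).
have px : p.[x] != 0.
  by rewrite -[_ == 0]/(root p x) root_prod_XsubC mem_filter eqxx.
have sum_p (r : seq K) :
    {subset r <= s ++ flatten [seq t i | i <- enum I]} ->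
    \sum_(y <- r) p.[y] = (count_mem x r)%:R * p.[x].
  move=> r_sub; rewrite (bigID (pred1 x)) /= [X in _ + X]big_seq_cond.
  rewrite [X in _ + X]big1 ?addr0 => [|y /andP[yr yx]]; last first.
    apply/eqP; rewrite -[_ == 0]/(root p y).
    by rewrite root_prod_XsubC mem_filter yx r_sub.
  rewrite (eq_bigr (fun=> p.[x])) => [|y /eqP -> //].
  by rewrite big_const_seq iter_addr_0 mulr_natl.
have := poly_eq p; rewrite sum_p => [|y ys]; last by rewrite mem_cat ys.
have tsub i : {subset t i <= s ++ flatten [seq t i | i <- enum I]}.
  move=> y yi; rewrite mem_cat; apply/orP; right.
  by apply/flatten_mapP; exists i; rewrite ?mem_enum.
rewrite (eq_bigr (fun i => (m i * count_mem x (t i))%:R * p.[x])); last first.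
  by move=> i _; rewrite (sum_p _ (tsub i)) natrM mulrA.
rewrite -mulr_suml -natr_sum => /(mulIf px)/eqP.
rewrite eqr_nat s_mult => /eqP ->.
by apply: eq_bigr => i _; rewrite (tP i).1.
Qed.

End Eigenvalues.

(** * Equivariant endomorphisms of indecomposable representations *)

Section Equivariant.
Variables (K : fieldType) (N : complete_network).
Implicit Types W U : rep K N.

Lemma equivariant_id W : equivariant (\1 : 'Hom(W, W)).
Proof. by move=> s; rewrite comp_lfun1l comp_lfun1r. Qed.

Lemma equivariant_comp U W (X : rep K N) (g : 'Hom(W, X)) (f : 'Hom(U, W)) :
  equivariant g -> equivariant f -> equivariant (g \o f)%VF.
Proof.
by move=> gE fE s; rewrite -comp_lfunA fE comp_lfunA gE comp_lfunA.
Qed.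

Lemma equivariantD U W (f g : 'Hom(U, W)) :
  equivariant f -> equivariant g -> equivariant (f + g).
Proof. by move=> fE gE s; rewrite comp_lfunDl comp_lfunDr fE gE. Qed.

Lemma equivariantZ U W a (f : 'Hom(U, W)) :
  equivariant f -> equivariant (a *: f).
Proof. by move=> fE s; rewrite -comp_lfunZl -comp_lfunZr fE. Qed.

Lemma equivariant_sum U W (I : finType) (f : I -> 'Hom(U, W)) :
  (forall i, equivariant (f i)) -> equivariant (\sum_i f i).
Proof.
move=> fE; elim/big_ind: _ => [s|f1 f2|//]; last exact: equivariantD.
by rewrite comp_lfun0l comp_lfun0r.
Qed.

Lemma equivariant_exp W (f : 'End(W)) k :
  equivariant (f : 'Hom(W, W)) -> equivariant (lfun_exp f k : 'Hom(W, W)).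
Proof.
move=> fE; elim: k => [|k IHk]; first exact: equivariant_id.
exact: equivariant_comp.
Qed.

Lemma limg_invariant U W (f : 'Hom(U, W)) :
  equivariant f -> invariant_subspace (limg f).
Proof. by move=> fE s; rewrite -limg_comp -fE limg_comp limgS ?subvf. Qed.

Lemma lker_invariant U W (f : 'Hom(U, W)) :
  equivariant f -> invariant_subspace (lker f).
Proof.
move=> fE s; apply/subvP => _ /memv_imgP[u fu0 ->].
move: fu0; rewrite !memv_ker => /eqP fu0.
by rewrite -comp_lfunE fE comp_lfunE fu0 linear0.
Qed.

Lemma lfun_expD (V : vectType K) (f : 'End(V)) j k v :
  lfun_exp f (j + k) v = lfun_exp f j (lfun_exp f k v).
Proof.
elim: j => [|j IHj]; first by rewrite id_lfunE.
by rewrite addSn /= !comp_lfunE IHj.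
Qed.

(** Fitting's lemma.  The kernels of f ^ (2 ^ j) cannot grow strictly for every
    j, since their dimensions are bounded; once ker (f ^ k) = ker (f ^ (2 k)),
    the kernel and the image of f ^ k are independent. *)
Lemma fitting (V : vectType K) (f : 'End(V)) : exists2 k, (0 < k)%N &
  (lker (lfun_exp f k) :&: limg (lfun_exp f k) = 0)%VS /\
  (lker (lfun_exp f k) + limg (lfun_exp f k) = {:V})%VS.
Proof.
pose d k := \dim (lker (lfun_exp f k)).
have /existsP[j] :
    [exists j : 'I_(\dim {:V}).+1, d (2 ^ j + 2 ^ j) <= d (2 ^ j)]%N.
  apply/contraT => /existsPn grow.
  have dj j : (j <= (\dim {:V}).+1 -> j <= d (2 ^ j))%N.
    elim: j => // j IHj lt_j; apply: leq_ltn_trans (IHj (ltnW lt_j)) _.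
    by rewrite expnS mul2n -addnn ltnNge (grow (Ordinal lt_j)).
  have := leq_trans (dj _ (leqnn _)) (dimvS (subvf _)).
  by rewrite ltnn.
set k := (2 ^ j)%N => le_d; exists k; first by rewrite expn_gt0.
have ker_eq v : lfun_exp f k (lfun_exp f k v) = 0 -> lfun_exp f k v = 0.
  have : (lker (lfun_exp f k) == lker (lfun_exp f (k + k)))%VS.
    rewrite eqEdim le_d andbT; apply/subvP => u; rewrite !memv_ker => /eqP u0.
    by rewrite lfun_expD u0 linear0.
  by move=> /eqP kk /eqP; rewrite -lfun_expD -memv_ker -kk memv_ker => /eqP.
have cap0 : (lker (lfun_exp f k) :&: limg (lfun_exp f k) = 0)%VS.
  apply/eqP; rewrite -subv0; apply/subvP => u; rewrite memv_cap memv0 memv_ker.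
  by case/andP => /eqP fu0 /memv_imgP[v _ uv]; rewrite uv ker_eq // -uv.
split=> //; apply/eqP; rewrite eqEdim subvf /=.
rewrite dimv_disjoint_sum //.
by rewrite -[X in (X <= _)%N](limg_ker_dim (lfun_exp f k)) capfv.
Qed.

(** The Fitting decomposition is invariant, so one of its two summands is zero;
    it is not the kernel of f ^ k, which contains that of f. *)
Lemma indecomposable_nilpotent W (f : 'Hom(W, W)) :
  indecomposable W -> equivariant f -> lker f != 0%VS ->
  exists k, lfun_exp f k = 0.
Proof.
move=> [_ indW] fE ker_f.
have [k k0 [cap0 sumT]] := fitting f; exists k.
have fkE := equivariant_exp k fE.
have kerI := lker_invariant fkE; have imgI := limg_invariant fkE.
have [ker0|img0] := indW _ _ kerI imgI sumT cap0.
  case/negP: ker_f; rewrite -subv0 -ker0; apply/subvP => u.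
  rewrite !memv_ker => /eqP fu0.
  case: k k0 {fkE cap0 sumT ker0 kerI imgI} => // k _.
  by rewrite -addn1 lfun_expD /= comp_lfunE id_lfunE fu0 linear0.
apply/lfunP => u; apply/eqP; rewrite zero_lfunE -memv0 -img0.
by rewrite memv_img ?memvf.
Qed.

End Equivariant.

Section Indecomposable.
Variables (K : numClosedFieldType) (N : complete_network).
Implicit Types W U : rep K N.

Lemma ltrace_nilpotent (V : vectType K) (f : 'End(V)) k :
  lfun_exp f k = 0 -> ltrace f = 0.
Proof.
move=> fk0; have [s [s_mult s_tr]] := spectrum f.
have := s_tr 1%N; rewrite /= comp_lfun1r => ->; rewrite big_seq big1 // => x xs.
have [|v v0 fv] := (alg_mult_eigen f x).1.
  by rewrite s_mult -has_count has_pred1.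
have : lfun_exp f k v = x ^+ k *: v.
  elim: k {fk0} => [|k IHk]; first by rewrite id_lfunE scale1r.
  by rewrite /= comp_lfunE IHk linearZ /= fv scalerA exprSr.
rewrite fk0 zero_lfunE => /esym/eqP.
by rewrite scaler_eq0 (negPf v0) orbF expf_eq0 expr1 => /andP[_ /eqP].
Qed.

(** Fitting's alternative in terms of traces: nilpotent maps have trace zero. *)
Lemma ltrace_noninjective W (f : 'Hom(W, W)) :
  indecomposable W -> equivariant f -> lker f != 0%VS -> ltrace f = 0.
Proof.
by move=> iW fE /(indecomposable_nilpotent iW fE)[k]; apply: ltrace_nilpotent.
Qed.

Lemma dim_indecomposable W : indecomposable W -> (\dim {:W})%:R != 0 :> K.
Proof. by case=> W0 _; rewrite pnatr_eq0 dimv_eq0; apply/eqP. Qed.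

Lemma eigenvalue_exists (V : vectType K) (f : 'End(V)) :
  ({:V} <> 0)%VS -> exists a, lker (f - a *: \1%VF) != 0%VS.
Proof.
move=> V0; have [[|a s] [s_mult s_tr]] := spectrum f.
  (* the trace of f ^ 0 is dim V, so the list of eigenvalues is not empty *)
  have := s_tr 0%N; rewrite big_nil /= ltrace1 => /eqP.
  by rewrite pnatr_eq0 dimv_eq0 => /eqP.
have [|v v0 fv] := (alg_mult_eigen f a).1; first by rewrite s_mult /= eqxx.
exists a; apply: contra v0 => /eqP ker0; rewrite -memv0 -ker0 memv_ker.
by rewrite !lfun_simp fv subrr.
Qed.

(** Write f = n + a with a an eigenvalue of f.  Then n is not injective, and
    neither is g o n, which has the same trace as n o g; so both traces are
    zero.  Hence tr (f o g) = a tr g and tr f = a dim W. *)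
Lemma ltrace_mul W (f g : 'Hom(W, W)) :
  indecomposable W -> equivariant f -> equivariant g ->
  ltrace (f \o g)%VF / (\dim {:W})%:R
  = ltrace f / (\dim {:W})%:R * (ltrace g / (\dim {:W})%:R).
Proof.
move=> iW fE gE; have dW := dim_indecomposable iW.
have [a ker_fa] := eigenvalue_exists f iW.1.
set n := f - a *: \1%VF in ker_fa.
have nE : equivariant (n : 'Hom(W, W)).
  apply: equivariantD => //; rewrite -scaleNr; apply: equivariantZ.
  exact: equivariant_id.
have tr_n : ltrace n = 0 by apply: ltrace_noninjective.
have fE' : f = n + a *: \1%VF by rewrite subrK.
have tr_ng : ltrace (n \o g)%VF = 0.
  rewrite ltraceC; apply: ltrace_noninjective => //.
    exact: equivariant_comp.
  apply: contra ker_fa => /eqP ker0; rewrite -subv0 -ker0; apply/subvP => u.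
  by rewrite !memv_ker comp_lfunE => /eqP ->; rewrite linear0.
clearbody n; rewrite fE' comp_lfunDl -comp_lfunZl comp_lfun1l.
rewrite !linearD !linearZ /=.
by rewrite tr_n tr_ng !add0r ltrace1 mulfK // mulrA.
Qed.

(** If the trace were nonzero, then g o f would be bijective, and U the direct
    sum of the invariant subspaces im f and ker g.  Since U is indecomposable,
    either f = 0, which contradicts W <> 0, or ker g = 0, which makes f an
    isomorphism. *)
Lemma ltrace_through W U (f : 'Hom(W, U)) (g : 'Hom(U, W)) :
  indecomposable W -> indecomposable U -> ~ rep_iso W U ->
  equivariant f -> equivariant g -> ltrace (g \o f)%VF = 0.
Proof.
move=> iW iU niso fE gE.
have [ker_gf|] := eqVneq (lker (g \o f)%VF) 0%VS; last first.
  by apply: ltrace_noninjective => //; apply: equivariant_comp.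
have /lker0P gf_inj : lker (g \o f)%VF == 0%VS by apply/eqP.
have kgf : lker (g \o f)%VF == 0%VS by apply/eqP.
have f_inj : injective f.
  by move=> x y fxy; apply: gf_inj; rewrite !comp_lfunE fxy.
have [||img0|ker0] := iU.2 _ _ (limg_invariant fE) (lker_invariant gE).
- apply/vspaceP => u; rewrite memvf; apply/memv_addP.
  pose w := ((g \o f)^-1 (g u))%VF.
  (* w is chosen so that g (f w) = g u, which puts u - f w in ker g *)
  exists (f w); first by rewrite memv_img ?memvf.
  exists (u - f w); last by rewrite addrC subrK.
  by rewrite memv_ker linearB /= -comp_lfunE lker0_lfunVK // subrr.
- apply/eqP; rewrite -subv0; apply/subvP => u; rewrite memv_cap memv0.
  case/andP => /memv_imgP[w _ ->]; rewrite memv_ker -comp_lfunE => /eqP gfw0.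
  by rewrite (gf_inj w 0) ?linear0.
- case: iW.1; apply/eqP; rewrite -subv0; apply/subvP => w _.
  have := memv_img f (memvf w); rewrite img0 !memv0 => /eqP fw0.
  by rewrite (f_inj w 0) ?linear0.
case: niso; exists f; split=> //.
have imgT : limg f = fullv.
  apply/vspaceP => u; rewrite memvf; apply/memv_imgP.
  exists (((g \o f)^-1 (g u))%VF); rewrite ?memvf //.
  by move/eqP/lker0P: ker0; apply; rewrite -comp_lfunE lker0_lfunVK.
exists (f^-1)%VF; first by apply: lker0_lfunK; apply/lker0P.
by move=> u; rewrite limg_lfunVK // imgT memvf.
Qed.

End Indecomposable.

(** * Normalized traces on the copies in a decomposition *)

Section Copies.
Variables (K : fieldType) (N : complete_network).
Variable D : decomposition K N.
Local Notation Wm l := (pow_rep (dec_comp D l) (dec_mult D l)).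
Local Notation Wsum := (sum_rep (fun l => Wm l)).

Definition to_copy l (i : 'I_(dec_mult D l)) :
    'Hom(regular_rep K N, dec_comp D l) :=
  (linfun (copy_out_fun i) \o dec_iso D)%VF.

Definition of_copy l (i : 'I_(dec_mult D l)) :
    'Hom(dec_comp D l, regular_rep K N) :=
  ((dec_iso D)^-1 \o linfun (copy_in_fun i))%VF.

Lemma componentE l (i j : 'I_(dec_mult D l)) F :
  component i j F = (to_copy i \o F \o of_copy j)%VF.
Proof. by rewrite /component /to_copy /of_copy !comp_lfunA. Qed.

Lemma dec_isoK : cancel (dec_iso D) (dec_iso D)^-1%VF.
Proof. by apply/lker0_lfunK/lker0P/bij_inj; case: (dec_isoP D). Qed.

Lemma dec_isoVK : cancel (dec_iso D)^-1%VF (dec_iso D).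
Proof.
move=> x; rewrite limg_lfunVK //; have [_ [h _ hK]] := dec_isoP D.
by rewrite -[x]hK memv_img ?memvf.
Qed.

Lemma copy_in_same l (i : 'I_(dec_mult D l)) w :
  ds_proj l (copy_in_fun i w) = single i w.
Proof. by rewrite ds_mkE dfwith_in. Qed.

Lemma copy_in_other l m (i : 'I_(dec_mult D l)) w :
  l != m -> ds_proj m (copy_in_fun i w) = 0.
Proof. by move=> lm; rewrite ds_mkE dfwith_out. Qed.

Lemma to_copy_equivariant l (i : 'I_(dec_mult D l)) : equivariant (to_copy i).
Proof.
move=> s; rewrite /to_copy -comp_lfunA (dec_isoP D).1 !comp_lfunA.
congr (_ \o _)%VF; apply/lfunP => x; rewrite !comp_lfunE !lfunE /=.
by rewrite /copy_out_fun ds_mkE lfunE /= ffunE.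
Qed.

Lemma of_copy_equivariant l (i : 'I_(dec_mult D l)) : equivariant (of_copy i).
Proof.
move=> s; apply/lfunP => w; rewrite !comp_lfunE; apply: (can_inj dec_isoK).
rewrite -[RHS]comp_lfunE (dec_isoP D).1 !comp_lfunE !dec_isoVK !lfunE /=.
apply/dsP => m; rewrite [RHS]ds_mkE.
have [<-|lm] := eqVneq l m; last by rewrite !copy_in_other ?linear0.
rewrite !copy_in_same lfunE /=; apply/ffunP => j; rewrite !ffunE.
by case: ifP; rewrite ?linear0.
Qed.

Lemma to_of_copy l (i j : 'I_(dec_mult D l)) :
  (to_copy i \o of_copy j)%VF = (i == j)%:R *: \1%VF.
Proof.
apply/lfunP => w; rewrite !comp_lfunE dec_isoVK scale_lfunE id_lfunE.
rewrite !lfunE /= /copy_out_fun copy_in_same ffunE.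
by case: eqP; rewrite ?scale1r ?scale0r.
Qed.

Lemma to_of_copy_other l m (i : 'I_(dec_mult D l)) (j : 'I_(dec_mult D m)) :
  l != m -> (to_copy i \o of_copy j)%VF = 0.
Proof.
move=> lm; apply/lfunP => w; rewrite !comp_lfunE dec_isoVK zero_lfunE.
by rewrite !lfunE /= /copy_out_fun copy_in_other 1?eq_sym // ffunE.
Qed.

Lemma copies_resolution :
  \sum_l \sum_i (of_copy i \o to_copy (l := l) i)%VF = \1%VF.
Proof.
apply/lfunP => x; rewrite id_lfunE; apply: (can_inj dec_isoK).
rewrite sum_lfunE linear_sum; apply/dsP => m; rewrite linear_sum (bigD1 m) //=.
rewrite [X in _ + X]big1 ?addr0 => [|l lm]; last first.
  rewrite sum_lfunE !linear_sum; apply: big1 => i _ /=.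
  by rewrite !comp_lfunE dec_isoVK lfunE /= copy_in_other.
rewrite sum_lfunE !linear_sum /=; apply/ffunP => i.
rewrite sum_ffunE (bigD1 i) //=.
rewrite [X in _ + X]big1 ?addr0 => [|j ji]; last first.
  rewrite !comp_lfunE dec_isoVK lfunE /= copy_in_same ffunE.
  by rewrite eq_sym (negPf ji).
rewrite !comp_lfunE dec_isoVK lfunE /= copy_in_same ffunE eqxx.
by rewrite lfunE.
Qed.

Definition endomorphism (F : 'End(regular_rep K N)) : Prop :=
  equivariant (F : 'Hom(regular_rep K N, regular_rep K N)).

End Copies.

Section NormalizedTraces.
Variables (K : numClosedFieldType) (N : complete_network).
Variable D : decomposition K N.

Lemma mult_entry_id l (i j : 'I_(dec_mult D l)) :
  mult_entry i j \1%VF = (i == j)%:R.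
Proof.
rewrite /mult_entry componentE comp_lfun1r to_of_copy linearZ /= ltrace1.
by rewrite mulfK // dim_indecomposable //; apply: comp_indecomposable.
Qed.

(** Inserting the resolution of the identity between F and G gives a sum over
    the copies of all the W_m.  The terms with m <> l factor through a
    non-isomorphic indecomposable, so their trace is zero; on those with m = l
    the normalized trace is multiplicative. *)
Lemma mult_entry_mul l (i j : 'I_(dec_mult D l)) F G :
  endomorphism F -> endomorphism G ->
  mult_entry i j (F \o G)%VF = \sum_k mult_entry i k F * mult_entry k j G.
Proof.
move=> FE GE; rewrite /mult_entry.
have -> : component i j (F \o G)%VF = \sum_m \sum_(k < dec_mult D m)
    ((to_copy i \o F \o of_copy k) \o (to_copy k \o G \o of_copy j))%VF.
  rewrite componentE -[F in LHS]comp_lfun1r -(copies_resolution D).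
  rewrite comp_lfun_sumr comp_lfun_suml comp_lfun_sumr comp_lfun_suml.
  apply: eq_bigr => m _.
  rewrite comp_lfun_sumr comp_lfun_suml comp_lfun_sumr comp_lfun_suml.
  by apply: eq_bigr => k _; rewrite !comp_lfunA.
have cE m m' (k : 'I_(dec_mult D m)) (k' : 'I_(dec_mult D m')) H :
    endomorphism H -> equivariant (to_copy k \o H \o of_copy k')%VF.
  move=> HE; apply: equivariant_comp; last exact: of_copy_equivariant.
  by apply: equivariant_comp => //; apply: to_copy_equivariant.
rewrite linear_sum mulr_suml (bigD1 l) //= [X in _ + X]big1 ?addr0 => [|m ml].
  rewrite linear_sum mulr_suml; apply: eq_bigr => k _; rewrite !componentE.
  by apply: ltrace_mul; [apply: comp_indecomposable | apply: cE..].
rewrite linear_sum big1 ?mul0r //= => k _; apply: ltrace_through.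
- exact: comp_indecomposable.
- exact: comp_indecomposable.
- by apply: comp_distinct => lm; rewrite lm eqxx in ml.
- exact: cE.
- exact: cE.
Qed.

Lemma ltrace_mult_entry F : ltrace F =
  \sum_l (\dim {:dec_comp D l})%:R * \sum_(i < dec_mult D l) mult_entry i i F.
Proof.
rewrite -[F in LHS]comp_lfun1r -(copies_resolution D) comp_lfun_sumr linear_sum.
apply: eq_bigr => l _; rewrite comp_lfun_sumr linear_sum mulr_sumr.
apply: eq_bigr => i _; rewrite /mult_entry componentE mulrC divfK.
  by rewrite /= comp_lfunA -[in RHS]comp_lfunA; apply: ltraceC.
by apply: dim_indecomposable; apply: comp_indecomposable.
Qed.

End NormalizedTraces.

(** * Admissible maps and their composition *)

Section Monoid.
Variable N : complete_network.
Local Notation S := (Sigma N).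

Lemma scompA : associative (@scomp N).
Proof. by move=> s t u; apply: val_inj; apply/ffunP => p; rewrite !ffunE. Qed.

Lemma scomp1s : left_id (sid N) (@scomp N).
Proof. by move=> s; apply: val_inj; apply/ffunP => p; rewrite !ffunE. Qed.

Lemma scomps1 : right_id (sid N) (@scomp N).
Proof. by move=> s; apply: val_inj; apply/ffunP => p; rewrite !ffunE. Qed.

(** Up to isomorphism, the input network of p is the image of the fundamental
    network under a fibration.  So p comes from a node k of the latter, where
    the identity is the associativity of Sigma. *)
Lemma constructible_inp (M : network S) : constructible (fundamental N) M ->
  forall s t (p : M), inp s (inp t p) = inp (scomp s t) p.
Proof.
move=> conM s t p; have [Q [[F [F_fib F_surj]] [G [G_fib G_bij]]]] := conM p.
pose p0 : input_network p := exist _ p (connect0 _ p).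
suff : inp s (inp t p0) = inp (scomp s t) p0 by move/(congr1 val).
apply: (bij_inj G_bij); rewrite !G_fib; have [k <-] := F_surj (G p0).
by rewrite -!F_fib /= scompA.
Qed.

(** The input network of the node k is the quotient of the fundamental network
    under s |-> s k. *)
Lemma fundamental_constructible : constructible (fundamental N) (fundamental N).
Proof.
move=> k; exists (input_network k); split; last first.
  by exists id; split=> //; exists id.
have reachk s : reach (k : fundamental N) (scomp s k).
  by apply: connect1; apply/existsP; exists s.
exists (fun s : fundamental N =>
  exist _ (scomp s k) (reachk s) : input_network k); split.
  by move=> s t; apply: val_inj; rewrite /= scompA.
case=> q kq; suff [s skq] : exists s, scomp s k = q.
  by exists s; apply: val_inj.
case/connectP: kq => r; elim: r k {reachk} => [|u r IHr] k /=.
  by move=> _ ->; exists (sid N); rewrite scomp1s.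
case/andP => /existsP[s /eqP <-] path_r q_last.
by have [t <-] := IHr _ path_r q_last; exists (scomp t s); rewrite scompA.
Qed.

End Monoid.

Section Responses.
Variables (K : fieldType) (N : complete_network).
Local Notation S := (Sigma N).
Local Notation Gamma := (admissible (fundamental N)).

Section AnySpace.
Variable V : vectType K.
Implicit Types f g h : 'Hom({ffun S -> V}, V).

Lemma GammaE f (x : {ffun S -> V}) k :
  Gamma f x k = f [ffun s => x (scomp s k)].
Proof. exact: admissibleE. Qed.

Lemma admissible_unit f x : Gamma f x (sid N) = f x.
Proof.
by rewrite GammaE; congr (f _); apply/ffunP => s; rewrite ffunE scomps1.
Qed.

Lemma Gamma_inj f g : Gamma f = Gamma g -> f = g.
Proof. by move=> fg; apply/lfunP => x; rewrite -!admissible_unit fg. Qed.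

(** Since the value of Gamma_h at the unit node is h, the response h of the
    composite of Gamma_f and Gamma_g must be f o Gamma_g. *)
Definition resp_comp f g : 'Hom({ffun S -> V}, V) := (f \o Gamma g)%VF.

Lemma admissible_comp (M : network S) f g :
  (forall s t (p : M), inp s (inp t p) = inp (scomp s t) p) ->
  (admissible M f \o admissible M g)%VF = admissible M (resp_comp f g).
Proof.
move=> inpM; apply/lfunP => x; apply/ffunP => p; rewrite comp_lfunE.
rewrite !admissibleE comp_lfunE; congr (f _); apply/ffunP => s.
rewrite ffunE admissibleE GammaE; congr (g _); apply/ffunP => t.
by rewrite !ffunE inpM.
Qed.

Lemma Gamma_comp f g : (Gamma f \o Gamma g)%VF = Gamma (resp_comp f g).
Proof. by apply: admissible_comp => s t p; rewrite /= scompA. Qed.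

Definition resp_unit : 'Hom({ffun S -> V}, V) := linfun (evaluation (sid N)).

Lemma Gamma_unit : Gamma resp_unit = \1%VF.
Proof.
apply/lfunP => x; apply/ffunP => k; rewrite admissibleE id_lfunE lfunE /=.
by rewrite /evaluation ffunE /= scomp1s.
Qed.

Definition resp_exp f k := iter k (resp_comp f) resp_unit.

Lemma Gamma_exp f k : Gamma (resp_exp f k) = lfun_exp (Gamma f) k.
Proof.
by elim: k => [|k IHk]; [apply: Gamma_unit | rewrite /= -IHk Gamma_comp].
Qed.

Lemma coefs_unit s : coefs resp_unit s = (s == sid N)%:R *: \1%VF.
Proof.
apply/lfunP => v; rewrite ffunE lfunE /= lfunE /= /evaluation ffunE eq_sym.
by rewrite scale_lfunE id_lfunE; case: eqP; rewrite ?scale1r ?scale0r.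
Qed.

Lemma coefs_comp f g r : coefs (resp_comp f g) r =
  \sum_s \sum_(t | scomp t s == r) (coefs f s \o coefs g t)%VF.
Proof.
apply/lfunP => v; rewrite ffunE lfunE /= comp_lfunE coefsE sum_lfunE.
apply: eq_bigr => s _; rewrite GammaE coefsE.
rewrite sum_lfunE linear_sum.
rewrite [RHS]big_mkcond; apply: eq_bigr => t _ /=.
rewrite !ffunE; case: ifP => _; first by rewrite comp_lfunE.
by rewrite !linear0.
Qed.

End AnySpace.

Lemma regular_actE s (x : {ffun S -> K^o}) k :
  act (regular_rep K N) s x k = x (scomp k s).
Proof. by rewrite lfunE ffunE. Qed.

Lemma Gamma_equivariant (f : 'Hom({ffun S -> K^o}, K^o)) :
  equivariant (Gamma f : 'Hom(regular_rep K N, regular_rep K N)).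
Proof.
move=> s; apply/lfunP => x; rewrite !comp_lfunE; apply/ffunP => k.
rewrite regular_actE !GammaE; congr (f _); apply/ffunP => t.
by rewrite !ffunE regular_actE scompA.
Qed.

(** By equivariance, (F x)_k = (F (A_k x))_id, where (A_k x)_s = x_(s k), so the
    value of F at the unit node determines F and is the required response. *)
Lemma equivariant_Gamma (F : 'End({ffun S -> K^o})) :
  equivariant (F : 'Hom(regular_rep K N, regular_rep K N)) ->
  F = Gamma (linfun (evaluation (sid N)) \o F)%VF.
Proof.
move=> FE; apply/lfunP => x; apply/ffunP => k.
rewrite GammaE comp_lfunE lfunE /= /evaluation.
have -> : [ffun s => x (scomp s k)] = act (regular_rep K N) k x.
  by apply/ffunP => s; rewrite ffunE regular_actE.
have := congr1 (fun G : 'Hom(regular_rep K N, regular_rep K N) =>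
  (G x : {ffun S -> K^o}) (sid N)) (FE k).
by rewrite !comp_lfunE regular_actE scomp1s => <-.
Qed.

End Responses.

(** * Network multipliers and the spectrum of the fundamental network *)

Section Spectrum.
Variables (K : numClosedFieldType) (N : complete_network).
Variable D : decomposition K N.
Local Notation S := (Sigma N).
Local Notation Gamma := (admissible (fundamental N)).

(** The admissible map of the response x |-> x_s: the basis of the admissible
    maps in which the coefficients of the multipliers are defined. *)
Definition shift (s : S) : 'End({ffun S -> K^o}) :=
  Gamma (scalar_resp [ffun t => (t == s)%:R]).

Lemma shiftE s x k : shift s x k = x (scomp s k).
Proof.
rewrite GammaE lfunE /= /scalar_resp_fun (bigD1 s) //= !ffunE eqxx mul1r.
by rewrite big1 ?addr0 // => t /negPf ts; rewrite ffunE ts mul0r.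
Qed.

Lemma shift_id : shift (sid N) = \1%VF.
Proof.
by apply/lfunP => x; apply/ffunP => k; rewrite shiftE id_lfunE scomp1s.
Qed.

Lemma shift_comp s t : (shift s \o shift t)%VF = shift (scomp t s).
Proof.
by apply/lfunP => x; apply/ffunP => k; rewrite comp_lfunE !shiftE scompA.
Qed.

Lemma shift_endo s : endomorphism (shift s).
Proof. exact: Gamma_equivariant. Qed.

Lemma ltrace_shift s : ltrace (shift s) = #|[pred k : S | scomp s k == k]|%:R.
Proof.
rewrite (@ltrace_admissible _ _ _ (fundamental N)).
rewrite (bigD1 s) //= big1 ?addr0 => [|t ts].
  have -> : coefs (scalar_resp [ffun t => (t == s)%:R]) s = \1%VF :> 'End(K^o).
    apply/lfunP => v; rewrite ffunE id_lfunE lfunE /= lfunE /= /scalar_resp_fun.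
    rewrite (bigD1 s) //= !ffunE eqxx mul1r big1 ?addr0 // => t /negPf ts.
    by rewrite !ffunE ts mul0r.
  by rewrite ltrace1 dimvf mulr1.
have -> : coefs (scalar_resp [ffun t => (t == s)%:R]) t = 0 :> 'End(K^o).
  apply/lfunP => v; rewrite ffunE zero_lfunE lfunE /= lfunE /= /scalar_resp_fun.
  rewrite big1 // => u _; rewrite !ffunE; case: (u =P t) => [->|_].
    by rewrite (negPf ts) mul0r.
  by rewrite mulr0.
by rewrite linear0 mulr0.
Qed.

Section Component.
Variable l : 'I_(ncomp D).
Implicit Types i j k : 'I_(dec_mult D l).

Lemma mult_coef_id i j : mult_coef i j (sid N) = (i == j)%:R.
Proof. by rewrite -(mult_entry_id i j) -shift_id. Qed.

(** The multiplicativity of normalized traces, applied to [shift s] and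
    [shift t], whose composition reverses the order of s and t. *)
Lemma mult_coef_comp i k s t :
  mult_coef i k (scomp t s) = \sum_j mult_coef i j s * mult_coef j k t.
Proof.
rewrite /mult_coef /mult_scalar -!/(shift _) -shift_comp.
by rewrite mult_entry_mul //; apply: shift_endo.
Qed.

Lemma multiplier_unit (V : vectType K) :
  multiplier l (coefs (resp_unit N V)) = \1%VF.
Proof.
rewrite -[RHS]scale1r -block_map_scalar; apply: eq_block_map => i j.
rewrite (bigD1 (sid N)) //= big1 ?addr0 => [|s /negPf sid'].
  by rewrite coefs_unit eqxx scale1r mult_coef_id mul1r.
by rewrite coefs_unit sid' scale0r scaler0.
Qed.

Lemma multiplier_comp (V : vectType K) (f g : 'Hom({ffun S -> V}, V)) :
  (multiplier l (coefs f) \o multiplier l (coefs g))%VF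
  = multiplier l (coefs (resp_comp f g)).
Proof.
rewrite /multiplier block_map_comp; apply: eq_block_map => i k.
transitivity (\sum_s \sum_t
  mult_coef i k (scomp t s) *: (coefs f s \o coefs g t)%VF).
  under eq_bigr do rewrite comp_lfun_suml.
  rewrite exchange_big; apply: eq_bigr => s _ /=.
  under eq_bigr do rewrite comp_lfun_sumr.
  rewrite exchange_big; apply: eq_bigr => t _ /=.
  rewrite mult_coef_comp scaler_suml; apply: eq_bigr => j _.
  by rewrite -comp_lfunZl -comp_lfunZr scalerA.
under [RHS]eq_bigr do rewrite coefs_comp scaler_sumr.
rewrite [RHS]exchange_big; apply: eq_bigr => s _ /=.
under [RHS]eq_bigr do rewrite scaler_sumr big_mkcond.
rewrite [RHS]exchange_big; apply: eq_bigr => t _ /=.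
by rewrite -big_mkcond (big_pred1 (scomp t s)) // => r; rewrite eq_sym.
Qed.

Lemma multiplier_exp (V : vectType K) (f : 'Hom({ffun S -> V}, V)) n :
  multiplier l (coefs (resp_exp f n)) = lfun_exp (multiplier l (coefs f)) n.
Proof.
elim: n => [|n IHn]; first exact: multiplier_unit.
by rewrite /= -IHn multiplier_comp.
Qed.

Lemma ltrace_multiplier (V : vectType K) (C : {ffun S -> 'End(V)}) :
  ltrace (multiplier l C)
  = \sum_s (\sum_(i < dec_mult D l) mult_coef i i s) * ltrace (C s).
Proof.
rewrite ltrace_block.
under eq_bigr do rewrite linear_sum.
rewrite exchange_big; apply: eq_bigr => s _ /=; rewrite mulr_suml.
by apply: eq_bigr => i _; rewrite linearZ.
Qed.

End Component.

(** Both sides are linear in the coefficients of f; the factor of tr (C_s) on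
    the left is the number of nodes fixed by s, that is, tr (shift s). *)
Lemma ltrace_Gamma (V : vectType K) (f : 'Hom({ffun S -> V}, V)) :
  ltrace (Gamma f)
  = \sum_l (\dim {:dec_comp D l})%:R * ltrace (multiplier l (coefs f)).
Proof.
rewrite (@ltrace_admissible _ _ _ (fundamental N)).
under [RHS]eq_bigr do rewrite ltrace_multiplier mulr_sumr.
rewrite [RHS]exchange_big; apply: eq_bigr => s _ /=.
rewrite -ltrace_shift (ltrace_mult_entry D) mulr_suml.
by apply: eq_bigr => l _; rewrite mulrA.
Qed.

(** The identity [ltrace_Gamma] passes to all powers, since f |-> Gamma_f and
    f |-> multiplier l (coefs f) carry the same product of responses to
    composition. *)
Lemma spectral_mults_dim :
  spectral_mults (fundamental N) [ffun l => \dim {:dec_comp D l}].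
Proof.
move=> V f x.
under eq_bigr do rewrite ffunE.
apply: alg_mult_of_traces => k; rewrite -Gamma_exp ltrace_Gamma.
by apply: eq_bigr => l _; rewrite multiplier_exp.
Qed.

Definition isotypic_proj (l : 'I_(ncomp D)) : 'End(regular_rep K N) :=
  \sum_i (of_copy i \o to_copy (l := l) i)%VF.

Lemma isotypic_proj_endo l : endomorphism (isotypic_proj l).
Proof.
apply: equivariant_sum => i.
exact: equivariant_comp (of_copy_equivariant i) (to_copy_equivariant i).
Qed.

Lemma isotypic_proj_of_copy l m (j : 'I_(dec_mult D m)) :
  (isotypic_proj l \o of_copy j)%VF = (l == m)%:R *: of_copy j.
Proof.
rewrite comp_lfun_suml; have [lm|lm] := eqVneq l m; last first.
  rewrite scale0r big1 // => i _.
  by rewrite -comp_lfunA to_of_copy_other ?comp_lfun0r.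
subst m; rewrite scale1r (bigD1 j) //= big1 ?addr0 => [|i /negPf ij].
  by rewrite -comp_lfunA to_of_copy eqxx scale1r comp_lfun1r.
by rewrite -comp_lfunA to_of_copy ij scale0r comp_lfun0r.
Qed.

Lemma mult_entry_isotypic_proj l m (i j : 'I_(dec_mult D m)) :
  mult_entry i j (isotypic_proj l) = (l == m)%:R * (i == j)%:R.
Proof.
rewrite -(mult_entry_id i j) /mult_entry !componentE -comp_lfunA.
rewrite isotypic_proj_of_copy -comp_lfunZr linearZ /= comp_lfun1r.
by rewrite mulrA.
Qed.

Definition isotypic_resp l : 'Hom({ffun S -> K^o}, K^o) :=
  (linfun (evaluation (sid N)) \o isotypic_proj l)%VF.

(** All responses here take values in the one-dimensional space K, where an
    endomorphism is the multiplication by its value at 1; so the blocks of the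
    multiplier are the scalars given by [mult_scalarE]. *)
Lemma multiplier_isotypic_resp l m :
  multiplier m (coefs (isotypic_resp l)) = (l == m)%:R *: \1%VF.
Proof.
rewrite -block_map_scalar; apply: eq_block_map => i j.
rewrite -mult_entry_isotypic_proj.
pose c := [ffun s => coefs (isotypic_resp l) s 1] : {ffun S -> K}.
have -> : isotypic_proj l = Gamma (scalar_resp c).
  rewrite [LHS](equivariant_Gamma (isotypic_proj_endo l)); congr (Gamma _).
  apply/lfunP => x; rewrite -/(isotypic_resp l) coefsE lfunE /=.
  apply: eq_bigr => s _; rewrite [c s]ffunE.
  exact: lfun_scalar.
rewrite -/(mult_scalar i j c) mult_scalarE scaler_suml; apply: eq_bigr => s _.
apply/lfunP => v; rewrite !scale_lfunE id_lfunE -[RHS]scalerA [c s]ffunE.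
congr (_ *: _); exact: lfun_scalar.
Qed.

(** The eigenvalue 1 of the response of the l-th isotypic projection occurs in
    the l-th multiplier only, so the equation for its multiplicity isolates
    m l. *)
Lemma spectral_mults_inj (M : network S) m m' :
  spectral_mults (D := D) M m -> spectral_mults M m' -> m = m'.
Proof.
move=> mP m'P; apply/ffunP => l.
have := mP _ (isotypic_resp l) 1; rewrite m'P.
have alg0 k : l != k ->
    alg_mult 1 (multiplier k (coefs (isotypic_resp l))) = 0%N.
  move=> lk; apply/eqP; rewrite -leqn0 leqNgt; apply/negP => /alg_mult_eigen[v].
  rewrite multiplier_isotypic_resp (negPf lk) scale0r zero_lfunE scale1r.
  by move=> v0 v00; rewrite v00 eqxx in v0.
have alg_pos : (0 < alg_mult 1 (multiplier l (coefs (isotypic_resp l))))%N.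
  apply/alg_mult_eigen; exists [ffun=> 1].
    apply/eqP => /ffunP/(_ (Ordinal (mult_ge1 l))); rewrite !ffunE.
    by move/eqP; rewrite oner_eq0.
  by rewrite multiplier_isotypic_resp eqxx !scale1r id_lfunE.
rewrite (bigD1 l) //= big1 ?addn0 => [|k kl]; last first.
  by rewrite alg0 ?muln0 // eq_sym.
rewrite (bigD1 l) //= big1 ?addn0 => [|k kl]; last first.
  by rewrite alg0 ?muln0 // eq_sym.
by move/eqP; rewrite eqn_pmul2r // => /eqP.
Qed.

End Spectrum.

Local Open Scope complex_scope.

Theorem theorem4p4 (R : realType) (N : complete_network)
    (D : decomposition R[i] N) :
  (constructible (fundamental N) (fundamental N) /\
   (exists! m : {ffun 'I_(ncomp D) -> nat},
      spectral_mults (fundamental N) m) /\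
   (forall m : {ffun 'I_(ncomp D) -> nat},
      spectral_mults (fundamental N) m -> forall l, m l <> 0%N)) /\
  (forall (V : vectType R[i]) (f g : 'Hom({ffun Sigma N -> V}, V)),
     (exists! h : 'Hom({ffun Sigma N -> V}, V),
        (admissible (fundamental N) f \o admissible (fundamental N) g)%VF
          = admissible (fundamental N) h) /\
     (forall h : 'Hom({ffun Sigma N -> V}, V),
        (admissible (fundamental N) f \o admissible (fundamental N) g)%VF
          = admissible (fundamental N) h ->
        (forall M : network (Sigma N), constructible (fundamental N) M ->
           (admissible M f \o admissible M g)%VF = admissible M h) /\
        (forall l : 'I_(ncomp D),
           (multiplier l (coefs f) \o multiplier l (coefs g))%VF
             = multiplier l (coefs h)))).
Proof.
split.
  split; first exact: fundamental_constructible.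
  split.
    exists [ffun l => \dim {:dec_comp D l}]; split.
      exact: spectral_mults_dim.
    by move=> m; apply: spectral_mults_inj; apply: spectral_mults_dim.
  move=> m mP l; rewrite -(spectral_mults_inj (spectral_mults_dim D) mP) ffunE.
  have := dim_indecomposable (comp_indecomposable l).
  by rewrite pnatr_eq0 => /eqP.
move=> V f g; split.
  exists (resp_comp f g); split; first exact: Gamma_comp.
  by move=> h; rewrite Gamma_comp => /Gamma_inj.
move=> h; rewrite Gamma_comp => /Gamma_inj <-; split=> [M conM|l].
  by apply: admissible_comp; apply: constructible_inp.
exact: multiplier_comp.
Qed.
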